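(* Let $X$ be a Noetherian space. The asymptotic subword topology on $X^{\leq\omega}$ is Alexandroff if and only if $X$ is essentially finite. Likewise, the asymptotic subword topology on $X^\omega$ is Alexandroff if and only if $X$ is essentially finite.
   Context: A topological space is Noetherian if every open subset is compact (no separation assumed). A topology is Alexandroff if every intersection of open sets is open. A space is essentially finite if it has only finitely many open subsets. $X^*$ is the set of finite words over $X$, $X^\omega$ the set of infinite words (functions $\mathbb{N} \to X$), and $X^{\leq\omega} = X^* \cup X^\omega$. For open subsets $U_1, \ldots, U_n, U$ of $X$ ($n \in \mathbb{N}$), $\langle U_1; \cdots; U_n\rangle$ is the set of finite or infinite words containing a letter in $U_1$, then at a later position a letter in $U_2$, and so on, until a letter in $U_n$ (for $n=0$, all words); $\langle U_1; \cdots; U_n; (\infty) U\rangle$ is the set of words that can be written as $uw$ with $u$ a finite word in $\langle U_1; \cdots; U_n\rangle$ and $w$ having letters from $U$ at infinitely many positions. The asymptotic subword topology on $X^{\leq\omega}$ is generated by all these sets as subbasic open sets; on $X^\omega$ it is the subspace topology. *)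

(* Defs.v *)
From HB Require Import structures.
From mathcomp Require Import all_boot all_order all_algebra.
From mathcomp Require Import all_classical all_reals all_analysis.

Set Implicit Arguments.
Unset Strict Implicit.
Unset Printing Implicit Defensive.

Local Open Scope classical_set_scope.

Definition noetherian (X : topologicalType) : Prop :=
  forall U : set X, open U -> compact U.

Definition alexandroff (X : topologicalType) : Prop :=
  forall F : set (set X), F `<=` open -> open (\bigcap_(U in F) U).

Definition essentially_finite (X : topologicalType) : Prop :=
  finite_set [set U : set X | open U].

(* Finite or infinite words over X. A dedicated inductive type rather than a
   sum, so that no topology already attached to sums, sequences or functions
   can be inferred for it. *)
Inductive word (X : Type) : Type :=
  | Fin of seq X
  | Inf of nat -> X.

HB.instance Definition _ (X : Type) := gen_eqMixin (word X).
HB.instance Definition _ (X : Type) := gen_choiceMixin (word X).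

Definition letter (X : Type) (w : word X) (i : nat) : option X :=
  match w with
  | Fin s => onth s i
  | Inf f => Some (f i)
  end.

(* Positions (counted from 0) at which w carries a letter from U. *)
Definition positions (X : Type) (U : set X) (w : word X) : set nat :=
  [set i | exists2 x, letter w i = Some x & U x].

Definition word_cons (X : Type) (x : X) (w : word X) : word X :=
  match w with
  | Fin s => Fin (x :: s)
  | Inf f => Inf (fun i => if i is j.+1 then f j else x)
  end.

Definition word_cat (X : Type) (u : seq X) (w : word X) : word X :=
  foldr (@word_cons X) w u.

(* <U_1; ...; U_n> *)
Definition subword_set (X : Type) (n : nat) (U : 'I_n -> set X) :
    set (word X) :=
  [set w | exists p : 'I_n -> nat,
     (forall i j : 'I_n, (i < j)%N -> (p i < p j)%N) /\
     (forall i : 'I_n, positions (U i) w (p i))].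

(* <U_1; ...; U_n; (oo) V> *)
Definition subword_inf_set (X : Type) (n : nat) (U : 'I_n -> set X)
    (V : set X) : set (word X) :=
  [set w | exists (u : seq X) (v : word X),
     [/\ w = word_cat u v, subword_set U (Fin u)
       & infinite_set (positions V v)]].

Definition subword_subbase (X : topologicalType) : set (set (word X)) :=
  [set A | exists (n : nat) (U : 'I_n -> set X),
     (forall i, open (U i)) /\ A = subword_set U] `|`
  [set A | exists (n : nat) (U : 'I_n -> set X) (V : set X),
     [/\ forall i, open (U i), open V & A = subword_inf_set U V]].

(* The asymptotic subword topology. *)
HB.instance Definition _ (X : topologicalType) :=
  isSubBaseTopological.Build (word X) (@subword_subbase X) id.

(* Infinite words with the subspace topology, i.e. the initial topology of the
   embedding Inf; [nat -> X] itself carries the product topology instead. *)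
Definition omega_word (X : topologicalType) : Type :=
  initial_topology (@Inf X).

HB.instance Definition _ (X : topologicalType) :=
  Topological.on (omega_word X).

(* Main.v *)
(* If X has finitely many open sets, every word w has a least neighbourhood.
   From some position N on, every open set containing a letter of w is visited
   infinitely often by w; one takes the words containing letters from the least
   neighbourhoods of the first N letters of w, in this order, and visiting
   infinitely often every open set that w does. Since <U_1; ...; U_n; (oo) V> is
   the intersection of <U_1; ...; U_n> with the words visiting V infinitely
   often, this is contained in every subbasic neighbourhood of w.

   Conversely, if the space of infinite words is Alexandroff then so is X,
   through the constant words. If X had infinitely many open sets, it would have
   infinitely many least neighbourhoods m(x), and compactness would give points
   x_0, x_1, ... with m(x_0), m(x_1), ... strictly decreasing. The intersection
   of all <(oo) m(x_n)> contains x_0 x_1 x_2 ..., but none of the words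
   x_0 ... x_k x_k x_k ..., which converge to it. *)
From HB Require Import structures.
Require Import Defs.
From mathcomp Require Import all_boot all_order all_algebra.
From mathcomp Require Import all_classical all_reals all_analysis.
From mathcomp Require Import finmap zify.

Set Implicit Arguments.
Unset Strict Implicit.
Unset Printing Implicit Defensive.

Local Open Scope classical_set_scope.

(** * Infinite sets of positions, finite intersections, Alexandroff spaces *)

Lemma infinite_set_natP (A : set nat) :
  infinite_set A <-> forall n, exists2 i, (n < i)%N & A i.
Proof.
split=> [Ainf n|Aunb /finite_seqP[s As]].
  have /infinite_setN0[i [Ai /negP]] := infinite_setD Ainf (finite_II n.+1).
  by rewrite -leqNgt; exists i.
have [i lt_i Ai] := Aunb (\max_(j <- s) j).
have si : i \in s by move: Ai; rewrite As.
by have := @leq_bigmax_seq _ s xpredT id i si isT; rewrite leqNgt lt_i.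
Qed.

Lemma finite_bigcap_closed (T : Type) (C F : set (set T)) :
  C setT -> setI_closed C -> finite_set F -> F `<=` C ->
  C (\bigcap_(A in F) A).
Proof.
move=> CT CI Ffin FC; rewrite -bigsetI_fset_set// big_seq.
by elim/big_ind: _ => // A; rewrite in_fset_set// in_setE => /FC.
Qed.

Lemma alexandroff_of_least (T : topologicalType) :
  (forall x : T, exists A : set T,
     [/\ open A, A x & forall B, open B -> B x -> A `<=` B]) ->
  alexandroff T.
Proof.
move=> least F Fop; rewrite openE => x Fx.
have [A [Aop Ax leastA]] := least x.
rewrite /interior nbhsE; exists A; first by split.
by move=> y Ay B FB; apply: leastA Ay; [exact: Fop|exact: Fx].
Qed.

(** * Open sets of words *)

(** An open set is a union of finite intersections of subbasic sets; [C setT] covers the empty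
    intersection. *)
Lemma word_open_ind (X : topologicalType) (C : set (set (word X))) :
  @subword_subbase X `<=` C -> C setT -> setI_closed C ->
  (forall F : set (set (word X)), F `<=` C -> C (\bigcup_(A in F) A)) ->
  open `<=` C.
Proof.
move=> sC CT CI CU B [D sD <-]; apply: CU => A /sD [E sE <-].
apply: finite_bigcap_closed => //; first exact: finite_fset.
by move=> i Ei; apply: sC; have := sE i Ei; rewrite in_setE.
Qed.

Lemma subword_subbase_open (X : topologicalType) (A : set (word X)) :
  subword_subbase A -> open A.
Proof.
move=> sA.
exists [set A]; last by rewrite bigcup_set1.
move=> _ ->; exists [fset A]%fset; last by rewrite set_fset1 bigcap_set1.
by move=> B; rewrite in_fset1 in_setE => /eqP->; exact: sA.
Qed.

Lemma letter_word_cat (X : Type) (u : seq X) (v : word X) (i : nat) :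
  letter (word_cat u v) i =
  if (i < size u)%N then onth u i else letter v (i - size u).
Proof.
elim: u i => [|x u IH] i /=; first by rewrite subn0.
case: i => [|i].
  by case: (word_cat u v) => //.
by rewrite ltnS subSS -IH; case: (word_cat u v).
Qed.

Lemma infinite_positions (X : Type) (V : set X) (w : word X) :
  infinite_set (positions V w) -> exists f, w = Inf f.
Proof.
case: w => [s|f]; last by exists f.
move=> /infinite_set_natP/(_ (size s))[i si [x]] /=.
by rewrite onthE nth_default// size_map ltnW.
Qed.

(** Prepending or deleting a finite prefix does not affect whether [V] is visited infinitely often.
    Hence an infinite word can be cut at any [N] beyond all the positions [p i]. *)
Lemma subword_inf_setE (X : Type) (n : nat) (U : 'I_n -> set X) (V : set X) :
  subword_inf_set U V =
  subword_set U `&` [set w | infinite_set (positions V w)].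
Proof.
apply/seteqP; split=> w;
  [move=> [u [v [-> [p [pinc pU]] Vinf]]]|move=> [[p [pinc pU]] Vinf]].
  have letu i x : onth u i = Some x -> letter (word_cat u v) i = Some x.
    rewrite letter_word_cat; case: ltnP => // le_ui.
    by rewrite onthE nth_default// size_map.
  split.
    exists p; split=> // i; have [x ux Ux] := pU i.
    by exists x => //; exact: letu.
  apply/infinite_set_natP => N.
  have /infinite_set_natP/(_ N)[i lt_Ni [x vx Vx]] := Vinf.
  exists (size u + i); first by rewrite (leq_trans lt_Ni)// leq_addl.
  exists x => //; rewrite letter_word_cat ifF; first by rewrite addKn.
  by rewrite ltnNge leq_addr.
have [f wf] := infinite_positions Vinf; subst w.
pose N := (\max_(i < n) p i).+1.
have pN i : (p i < N)%N by rewrite ltnS leq_bigmax.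
have sN : size (mkseq f N) = N by rewrite size_mkseq.
have letN i : (i < N)%N -> onth (mkseq f N) i = Some (f i).
  by move=> iN; rewrite onthE (nth_map (f 0)) ?sN// nth_mkseq.
exists (mkseq f N), (Inf (fun i => f (N + i))); split.
- have catI (u : seq X) (g : nat -> X) : exists h, word_cat u (Inf g) = Inf h.
    by elim: u => [|x u [h /= ->]]; eexists.
  have [h eqh] := catI (mkseq f N) (fun i => f (N + i)).
  rewrite eqh; congr Inf; apply/funext => i.
  apply/Some_inj; rewrite -[RHS]/(letter (Inf h) i) -eqh letter_word_cat sN.
  by case: ltnP => [/letN->//|Ni] /=; rewrite subnKC.
- exists p; split=> // i; have [x [<-] Ux] := pU i.
  by exists (f (p i)) => //=; exact: letN.
- apply/infinite_set_natP => k.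
  have /infinite_set_natP/(_ (N + k))[i lt_i [x [<-] Vx]] := Vinf.
  exists (i - N); first by lia.
  by exists (f i) => //=; congr (Some (f _)); lia.
Qed.

Lemma subword_set_open (X : topologicalType) (n : nat) (U : 'I_n -> set X) :
  (forall i, open (U i)) -> open (subword_set U).
Proof. by move=> Uop; apply: subword_subbase_open; left; exists n, U. Qed.

Lemma infinite_positions_open (X : topologicalType) (V : set X) :
  open V -> open [set w : word X | infinite_set (positions V w)].
Proof.
move=> Vop.
rewrite (_ : [set _ | _] = subword_inf_set (fun _ : 'I_0 => setT) V).
  apply: subword_subbase_open; right; exists 0%N, (fun=> setT), V; split=> // i.
  exact: openT.
rewrite subword_inf_setE; apply/seteqP; split=> [w Vw|w []//]; split=> //.
by exists (fun=> 0%N); split=> -[].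
Qed.

Lemma word_open_ind_positions (X : topologicalType) (C : set (set (word X))) :
  (forall n (U : 'I_n -> set X), (forall i, open (U i)) -> C (subword_set U)) ->
  (forall V : set X, open V -> C [set w | infinite_set (positions V w)]) ->
  setI_closed C ->
  (forall F : set (set (word X)), F `<=` C -> C (\bigcup_(A in F) A)) ->
  open `<=` C.
Proof.
move=> CU CV CI Cbig; apply: word_open_ind => //.
  move=> A [[n [U [Uop ->]]]|[n [U [V [Uop Vop ->]]]]]; first exact: CU.
  by rewrite subword_inf_setE; apply: CI; [exact: CU|exact: CV].
rewrite (_ : setT = subword_set (fun _ : 'I_0 => setT)).
  by apply: CU => i; exact: openT.
by apply/seteqP; split=> // w _; exists (fun=> 0%N); split=> -[].
Qed.


(** * Least neighbourhoods *)

(** This is the upward closure of [x] in the specialization preorder. It need not be open unless [X]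
    is Alexandroff. *)
Definition min_nbhd (X : topologicalType) (x : X) : set X :=
  \bigcap_(U in [set U | open U /\ U x]) U.

Lemma min_nbhd_refl (X : topologicalType) (x : X) : min_nbhd x x.
Proof. by move=> U []. Qed.

Lemma min_nbhd_sub (X : topologicalType) (x : X) (U : set X) :
  open U -> U x -> min_nbhd x `<=` U.
Proof. by move=> Uop Ux y; apply; split. Qed.

Lemma alexandroff_min_nbhd_open (X : topologicalType) (x : X) :
  alexandroff X -> open (min_nbhd x).
Proof. by apply=> U []. Qed.

Lemma essentially_finite_alexandroff (X : topologicalType) :
  essentially_finite X -> alexandroff X.
Proof.
move=> Xfin F Fop; apply: finite_bigcap_closed => //.
- exact: openT.
- exact: openI.
- exact: sub_finite_set Xfin.
Qed.

(** An open set is the union of the least neighbourhoods it contains, so it is determined by a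
    subset of the finite list [s]. *)
Lemma min_nbhds_finite (X : topologicalType) :
  finite_set (range (@min_nbhd X)) -> essentially_finite X.
Proof.
move=> /finite_seqP[s rs].
apply: (@sub_finite_set _ _
  ((fun B : {set 'I_(size s)} =>
      \bigcup_(i in [set i : 'I_(size s) | i \in B]) nth set0 s i)
   @` setT)); last first.
  exact/finite_image/finite_finset.
move=> U Uop.
exists [set i : 'I_(size s) | `[< nth set0 s i `<=` U >]]%SET => //.
apply/seteqP; split=> [y [i /=]|y Uy].
  by rewrite finset.inE => /asboolP; apply.
have : [set` s] (min_nbhd y) by rewrite -rs; exists y.
move=> /= ys; have lty : (index (min_nbhd y) s < size s)%N by rewrite index_mem.
exists (Ordinal lty) => /=; last by rewrite nth_index//; exact: min_nbhd_refl.
by rewrite finset.inE /= nth_index//; apply/asboolP; exact: min_nbhd_sub.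
Qed.

(** * From finitely many open sets to least neighbourhoods of words *)

Lemma increasing_extension (n : nat) (p : nat -> nat)
    (R : nat -> set nat) :
  (forall i j, (i < j < n)%N -> (p i < p j)%N) ->
  (forall i, (i < n)%N -> R i (p i)) ->
  (forall i, (n <= i)%N -> infinite_set (R i)) ->
  exists g : nat -> nat,
    (forall i j, (i < j)%N -> (g i < g j)%N) /\ forall i, R i (g i).
Proof.
(* The pair [il] holds an index and the value at the preceding index. From index [n] on, infinitude
   of [R] leaves room above that value. *)
move=> pinc pR Rinf.
have next il : exists k, if (il.1 < n)%N then k = p il.1
                         else (il.2 < k)%N /\ R il.1 k.
  case: ltnP => [_|le_n]; first by exists (p il.1).
  by have /infinite_set_natP/(_ il.2)[k] := Rinf _ le_n; exists k.
have [h hP] := choice next.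
pose g := fix g i := if i is j.+1 then h (i, g j) else h (0, 0)%N.
have gE i : exists l, g i = h (i, l) by case: i => [|i]; eexists.
have gp i : (i < n)%N -> g i = p i.
  by move=> lt_in; have [l ->] := gE i; have := hP (i, l); rewrite /= lt_in.
exists g; split=> [|i]; last first.
  have [l ->] := gE i; have := hP (i, l) => /=.
  by case: ltnP => [/pR Rp ->|_ []].
have step i : (g i < g i.+1)%N.
  have [lt_in|le_ni] := ltnP i.+1 n.
    by rewrite !gp ?(ltnW lt_in)//; apply: pinc; rewrite ltnSn.
  by have := hP (i.+1, g i); rewrite /= ltnNge le_ni /= => -[].
exact: (ssrnat.homo_ltn (r := fun a b => (a < b)%N)
         (fun y x z => @ltn_trans y x z) step).
Qed.

(** The subword preorder of Higman, extended to infinite words, with letters compared by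
    specialization. Past the end of a finite [w], [g] only has to increase. *)
Definition word_embeds (X : topologicalType) (w w' : word X) : Prop :=
  exists g : nat -> nat,
    (forall i j, (i < j)%N -> (g i < g j)%N) /\
    forall i x, letter w i = Some x -> positions (min_nbhd x) w' (g i).

Lemma subword_set_embeds (X : topologicalType) (n : nat) (U : 'I_n -> set X)
    (w w' : word X) :
  (forall i, open (U i)) -> word_embeds w w' -> subword_set U w ->
  subword_set U w'.
Proof.
move=> Uop [g [ginc gw]] [p [pinc pU]]; exists (g \o p); split.
  by move=> i j /pinc/ginc.
move=> i; have [x /gw [y w'y xy] Ux] := pU i.
by exists y => //; apply: min_nbhd_sub xy.
Qed.

(** An open set visited finitely often has a bound on its visits; with finitely many open sets,
    these bounds have a maximum. *)
Lemma essentially_finite_tail (X : topologicalType) (f : nat -> X) :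
  essentially_finite X ->
  exists N, forall k V, (N <= k)%N -> open V -> V (f k) ->
    infinite_set [set i | V (f i)].
Proof.
move=> Xfin.
have bound (V : set X) : exists N, forall k, (N <= k)%N -> V (f k) ->
    infinite_set [set i | V (f i)].
  have [Vinf|/contrapT/finite_seqP[s sV]] :=
    pselect (infinite_set [set i | V (f i)]).
    by exists 0%N.
  exists (\max_(i <- s) i).+1 => k lt_k Vk; exfalso.
  have ks : k \in s by have : [set` s] k by rewrite -sV.
  by have := @leq_bigmax_seq _ s xpredT id k ks isT; rewrite leqNgt lt_k.
have [b bP] := choice bound.
have /finite_seqP[s sb] := finite_image b Xfin.
exists (\max_(i <- s) i) => k V le_k Vop; apply: bP; apply: leq_trans le_k.
have Vs : b V \in s by have : [set` s] (b V) by rewrite -sb; exists V.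
exact: (@leq_bigmax_seq _ s xpredT id (b V) Vs isT).
Qed.

Lemma infinite_positions_Inf (X : Type) (V : set X) (f : nat -> X) :
  positions V (Inf f) = [set i | V (f i)].
Proof.
by apply/seteqP; split=> [i [x [<-]]|i Vi] //=; exists (f i).
Qed.

Lemma essentially_finite_word_alexandroff (X : topologicalType) :
  essentially_finite X -> alexandroff (word X).
Proof.
move=> Xfin; apply: alexandroff_of_least => w.
have mop x : open (@min_nbhd X x).
  exact/alexandroff_min_nbhd_open/essentially_finite_alexandroff.
pose rec := [set V : set X | open V /\ infinite_set (positions V w)].
(* For a finite word [N] is the length, which makes the tail condition vacuous. *)
have [N [pre tail]] : exists N,
    (forall k, (k < N)%N -> exists x, letter w k = Some x) /\
    forall k x, (N <= k)%N -> letter w k = Some x -> rec (min_nbhd x).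
  rewrite {}/rec; case: w => [s|f].
    exists (size s); split=> [k lt_k|k x le_k] /=; last first.
      by rewrite onthE nth_default// size_map.
    by case: s lt_k => // y s lt_k; rewrite onthE (nth_map y)//; eexists.
  have [N NP] := essentially_finite_tail f Xfin.
  exists N; split=> [k _|k x le_k [<-]]; first by eexists.
  split=> //; rewrite infinite_positions_Inf.
  by apply: (NP k) => //; exact: min_nbhd_refl.
(* [L i] is the least neighbourhood of the letter at [i]; the union avoids choosing a default
   letter. *)
pose L (i : 'I_N) : set X :=
  \bigcup_(x in [set x | letter w i = Some x]) min_nbhd x.
pose G := [set [set w' : word X | infinite_set (positions V w')] | V in rec].
exists (subword_set L `&` \bigcap_(B in G) B); split.
- apply: openI.
    by apply: subword_set_open => i; apply: bigcup_open.
  apply: finite_bigcap_closed.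
  + exact: openT.
  + exact: openI.
  + by apply/finite_image/(sub_finite_set _ Xfin) => V [].
  + by move=> _ [V [Vop _] <-]; exact: infinite_positions_open.
- split; last by move=> _ [V [_ Vinf] <-].
  exists id; split=> // i; have [x wx] := pre i (ltn_ord i).
  by exists x => //; exists x => //; exact: min_nbhd_refl.
(* Induction on the open set [B], for the property that if [B] contains [w] then it contains the
   whole candidate neighbourhood. *)
apply: word_open_ind_positions =>
  [n U Uop Uw w'|V Vop Vw w' [_]|A B CA CB|F FC].
- move=> [[p [pinc pL]] Ginf]; apply: subword_set_embeds Uw => //.
  (* The default 0 occurs only from [N] on, where [q] is not constrained. Past the end of a finite
     [w], [R i] is all of [nat], hence infinite. *)
  pose q i := if insub i is Some j then p j else 0%N.
  pose R i := [set k | forall x, letter w i = Some x ->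
                       positions (min_nbhd x) w' k].
  apply: (@increasing_extension N q R) =>
    [i j /andP[lt_ij lt_jN]|i lt_iN|i le_Ni].
  + by rewrite /q !insubT ?(ltn_trans lt_ij)// => lt_iN; apply: pinc.
  + move=> x wx; rewrite /q insubT /=.
    have [y w'y [x' /=]] := pL (Ordinal lt_iN).
    by rewrite wx => -[<-] xy; exists y.
  + case wi: (letter w i) => [x|].
      have := Ginf _ (imageP _ (tail i x le_Ni wi)).
      by apply: sub_infinite_set => k xk y; rewrite wi => -[<-].
    by apply: sub_infinite_set infinite_nat => k _ x; rewrite wi.
- move=> Ginf; apply: (Ginf [set w' | infinite_set (positions V w')]).
  by exists V.
- by move=> [/CA sA /CB sB] w' Aw'; split; [exact: sA|exact: sB].
- by move=> [B FB /(FC _ FB) sB] w' /sB; exists B.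
Qed.

(** * From words to infinite words, and from these to the base space *)

Lemma word_alexandroff_omega (X : topologicalType) :
  alexandroff (word X) -> alexandroff (omega_word X).
Proof.
move=> aX F Fop.
(* Taking every open set whose trace lies in [F] avoids choosing one extension for each member of
   [F]. *)
exists (\bigcap_(B in [set B : set (word X) | open B /\ F (@Inf X @^-1` B)]) B).
  by apply: aX => B [].
apply/seteqP; split=> [f FB A FA|f FA B [Bop FB]]; last exact: FA FB.
have [B Bop BA] := Fop A FA.
by rewrite -BA; apply: FB; split=> //; rewrite BA.
Qed.

(** This is continuity of the constant-word map: it pulls [subword_set U] back to the intersection
    of the [U i], and the words visiting [V] infinitely often back to [V]. *)
Lemma constant_words_open (X : topologicalType) (B : set (word X)) :
  open B -> open [set x : X | B (Inf (fun=> x))].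
Proof.
move: B; apply: word_open_ind_positions => [n U Uop|V Vop|A B|F FC].
- rewrite (_ : [set x | _] = \bigcap_(A in range U) A).
    apply: finite_bigcap_closed.
    + exact: openT.
    + exact: openI.
    + exact/finite_image/finite_finset.
    + by move=> _ [i _ <-].
  apply/seteqP; split=> [x [p [_ pU]] _ [i _ <-]|x Ux].
    by have [y [<-]] := pU i.
  exists val; split=> // i; exists x => //; apply: Ux; exact: imageP.
- rewrite (_ : [set x | _] = V)//; apply/seteqP; split=> x /=.
    by rewrite infinite_positions_Inf => /infinite_setN0[].
  move=> Vx; rewrite infinite_positions_Inf.
  by apply: sub_infinite_set infinite_nat => i.
- exact: openI.
- rewrite (_ : [set x | _] = \bigcup_(A in F) [set x | A (Inf (fun=> x))])//.
  exact: bigcup_open.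
Qed.

(** The words having a letter in [U] form an open set whose trace on constant words is [U], so
    intersections in [X] are pulled back from intersections of open sets of infinite words. *)
Lemma omega_alexandroff_base (X : topologicalType) :
  alexandroff (omega_word X) -> alexandroff X.
Proof.
move=> aw F Fop.
pose S (U : set X) : set (word X) := [set w | positions U w !=set0].
have Sop U : open U -> open (S U).
  move=> Uop; rewrite (_ : S U = subword_set (fun _ : 'I_1 => U)).
    exact: subword_set_open.
  apply/seteqP; split=> w; last by move=> [p [_ /(_ ord0)]]; exists (p ord0).
  move=> [i Ui]; exists (fun=> i); split=> // j k.
  by rewrite !ord1.
have [|B Bop BE] := aw [set @Inf X @^-1` S U | U in F].
  by move=> _ [U FU <-]; exists (S U) => //; exact/Sop/Fop.
rewrite (_ : \bigcap_(U in F) U = [set x : X | B (Inf (fun=> x))]).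
  exact: constant_words_open.
rewrite -[RHS]/[set x : X | (@Inf X @^-1` B) (fun=> x)] BE.
apply/seteqP; split=> x.
  by move=> Fx _ [U FU <-]; exists 0%N, x => //; exact: Fx.
by move=> H U FU; have [_ [y [<-]]] := H _ (imageP _ FU).
Qed.

(* The library proves this for pointed spaces only. *)
Lemma compact_cover_compact (X : topologicalType) (x0 : X) (A : set X) :
  compact A -> cover_compact A.
Proof.
pose PX := HB.pack_for ptopologicalType X (isPointed.Build X x0).
move=> cA; have cA' : @compact PX A by exact: cA.
by move: cA'; rewrite compact_cover.
Qed.

(** * Strictly decreasing least neighbourhoods *)

(** By compactness, finitely many [min_nbhd x] with [x] in [D] cover all the others. Each of the
    others equals one of these or lies strictly below one, so some [x] has infinitely many below
    it. *)
Lemma infinite_below (X : topologicalType) (D : set X) :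
  noetherian X -> alexandroff X -> infinite_set (@min_nbhd X @` D) ->
  exists2 x, D x &
    infinite_set (@min_nbhd X @` [set y | D y /\ min_nbhd y `<` min_nbhd x]).
Proof.
move=> nX aX Dinf; have [_ [x0 _ _]] := infinite_setN0 Dinf.
move: Dinf; apply: contra_notP => nD.
have mop x : open (@min_nbhd X x) by exact: alexandroff_min_nbhd_open.
have := nX (\bigcup_(x in D) min_nbhd x) (bigcup_open (fun x _ => mop x)).
move=> /(compact_cover_compact x0)/(_ X D (@min_nbhd X) (fun x _ => mop x)).
move=> /(_ (@subset_refl _ _))[E ED cov].
apply: (@sub_finite_set _ _ (\bigcup_(x in [set` E])
  ([set min_nbhd x] `|`
   @min_nbhd X @` [set y | D y /\ min_nbhd y `<` min_nbhd x]))).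
  move=> _ [y Dy <-].
  have [|x Ex xy] := cov y; first by exists y => //; exact: min_nbhd_refl.
  exists x => //; have [->|nyx] := pselect (min_nbhd y = min_nbhd x).
    by left.
  right; exists y => //; split=> //; rewrite properEneq; split.
    exact/eqP.
  exact: min_nbhd_sub.
apply: bigcup_finite => [|x Ex]; first exact: finite_fset.
rewrite finite_setU; split; first exact: finite_set1.
apply: contrapT => inf; apply: nD; exists x => //.
by have := ED x Ex; rewrite in_setE.
Qed.

Lemma decreasing_min_nbhds (X : topologicalType) :
  noetherian X -> alexandroff X -> infinite_set (range (@min_nbhd X)) ->
  exists x : nat -> X, forall n, min_nbhd (x n.+1) `<` min_nbhd (x n).
Proof.
move=> nX aX rinf.
(* The invariant [big] lets [infinite_below] be applied again, with [D] the points strictly below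
   the current one. *)
pose big x := infinite_set (@min_nbhd X @` [set y | min_nbhd y `<` min_nbhd x]).
have [x0 _ x0big] := infinite_below nX aX rinf.
have big0 : big x0 by apply: sub_infinite_set x0big => _ [y [_ ?] <-]; exists y.
have next (x : {x | big x}) : exists y : {x | big x},
    min_nbhd (sval y) `<` min_nbhd (sval x).
  have [y yx ybig] := infinite_below nX aX (svalP x).
  have bigy : big y by apply: sub_infinite_set ybig => _ [z [_ ?] <-]; exists z.
  by exists (exist _ y bigy).
have [h hP] := choice next.
exists (fun n => sval (iter n h (exist _ x0 big0))) => n.
exact: hP.
Qed.

(** * Truncated words and the converse *)

(** With [minn i k] the word stays at [x k] from position [k] on. An open [V] containing some [x n]
    contains [x k] for all later [k], so these truncations visit [V] forever. *)
Lemma truncations_converge (X : topologicalType) (x : nat -> X) :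
  (forall n k, (n <= k)%N -> min_nbhd (x n) (x k)) ->
  forall B : set (word X), open B -> B (Inf x) ->
  exists N, forall k, (N <= k)%N -> B (Inf (fun i => x (minn i k))).
Proof.
move=> xm; apply: word_open_ind_positions.
- move=> n U Uop [p [pinc pU]]; exists (\max_(i < n) p i) => k le_k.
  exists p; split=> // i; have [y /= [<-] Uy] := pU i.
  exists (x (p i)) => //=; rewrite (minn_idPl _)//.
  by apply: leq_trans le_k; exact: leq_bigmax.
- move=> V Vop /=; rewrite infinite_positions_Inf => /infinite_setN0[n Vn].
  exists n => k le_nk; rewrite infinite_positions_Inf.
  apply/infinite_set_natP => m; exists (maxn m.+1 k); first by rewrite leq_maxl.
  rewrite /= (minn_idPr _) ?leq_maxr//.
  exact: (min_nbhd_sub Vop Vn) (xm _ _ le_nk).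
- move=> A B CA CB [/CA[M MP] /CB[N NP]]; exists (maxn M N) => k.
  by rewrite geq_max => /andP[/MP ? /NP].
- by move=> F FC [B FB /(FC _ FB)[N NP]]; exists N => k /NP; exists B.
Qed.

Lemma omega_alexandroff_essentially_finite (X : topologicalType) :
  noetherian X -> alexandroff (omega_word X) -> essentially_finite X.
Proof.
move=> nX aw; have aX := omega_alexandroff_base aw.
apply: min_nbhds_finite; apply: contrapT => rinf.
have [x xdec] := decreasing_min_nbhds nX aX rinf.
have mono n k : (n <= k)%N -> min_nbhd (x k) `<=` min_nbhd (x n).
  move=> /subnK <-; elim: (k - n)%N => // i IH.
  exact: subset_trans (properW (xdec _)) IH.
have xm n k : (n <= k)%N -> min_nbhd (x n) (x k).
  by move=> /mono; apply; exact: min_nbhd_refl.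
have notm k : ~ min_nbhd (x k.+1) (x k).
  move=> xk; have [_] := xdec k; apply; apply: min_nbhd_sub => //.
  exact: alexandroff_min_nbhd_open.
pose J n := [set w : word X | infinite_set (positions (min_nbhd (x n)) w)].
have [|B Bop BE] := aw [set @Inf X @^-1` J n | n in setT].
  move=> _ [n _ <-]; exists (J n) => //; apply: infinite_positions_open.
  exact: alexandroff_min_nbhd_open.
have Bx : (@Inf X @^-1` B) x.
  rewrite BE => _ [n _ <-]; rewrite /J /= infinite_positions_Inf.
  apply/infinite_set_natP => m; exists (maxn m.+1 n); first by rewrite leq_maxl.
  by apply: xm; rewrite leq_maxr.
have [N /(_ N (leqnn N)) BN] := truncations_converge xm Bop Bx.
have : (@Inf X @^-1` B) (fun i => x (minn i N)) by [].
(* The truncation at [N] has only the letters [x 0] to [x N], and none of them lies in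
   [min_nbhd (x N.+1)]. *)
rewrite BE => /(_ _ (imageP _ (I : [set: nat] N.+1))).
rewrite /J /= infinite_positions_Inf => /infinite_setN0[i /= xi].
apply: (notm (minn i N)).
by apply: mono xi; rewrite ltnS geq_minr.
Qed.

Theorem proposition5p18 (X : topologicalType) (hX : noetherian X) :
  (alexandroff (word X) <-> essentially_finite X) /\
  (alexandroff (omega_word X) <-> essentially_finite X).
Proof.
have EW := @essentially_finite_word_alexandroff X.
have WO := @word_alexandroff_omega X.
have OE := omega_alexandroff_essentially_finite hX.
by split; split=> // ?; [exact/OE/WO|exact/WO/EW].
Qed.
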